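(* Let $m\in\mathbb{N}$, $p\in[1,\infty)$, let $\|\cdot\|$ be a norm on $\mathbb{R}^m$, let $\mathcal{Y}\subseteq\mathbb{R}^m$ be closed with the metric induced by $\|\cdot\|$, and let $\mathfrak{C}$ be a polyhedral cover of $\mathcal{Y}$ with mesh size $\eta(\mathfrak{C})$. (i) If $\mathfrak{C}$ is bounded and $\mathcal{G}$ is an interpolation function set for $\mathfrak{C}$, then for all $\mu,\nu\in\mathcal{P}_p(\mathcal{Y};\mathcal{G})$ with $\mu\overset{\mathcal{G}}{\sim}\nu$ we have $W_p(\mu,\nu)\le2\eta(\mathfrak{C})$. (ii) If $\mathfrak{C}$ is unbounded and $\mathcal{G}$ is a $p$-interpolation function set for $\mathfrak{C}$ with $\{\overline{g}_{\boldsymbol{u}}:\boldsymbol{u}\in D(\mathfrak{C})\}\subset\operatorname{span}_1(\mathcal{G})$ a $p$-radial function set, then for all $\mu,\nu\in\mathcal{P}_p(\mathcal{Y};\mathcal{G})$ with $\mu\overset{\mathcal{G}}{\sim}\nu$ we have $$W_p(\mu,\nu)\le2\eta(\mathfrak{C})+2\Big(\sum_{\boldsymbol{u}\in D(\mathfrak{C})}\int_{\mathcal{Y}}\overline{g}_{\boldsymbol{u}}\,\mathrm{d}\mu\Big)^{1/p}.$$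
   Context: $\mathcal{P}_p(\mathcal{Y})$: Borel probability measures with finite $p$-th moment; $W_p$: Wasserstein distance of order $p$. For a collection $\mathcal{G}$ of real Borel functions on $\mathcal{Y}$, $\mathcal{P}_p(\mathcal{Y};\mathcal{G}):=\{\mu\in\mathcal{P}_p(\mathcal{Y}):\mathcal{G}\subseteq\mathcal{L}^p(\mathcal{Y},\mu)\}$, and $\mu\overset{\mathcal{G}}{\sim}\nu$ means $\int g\,\mathrm{d}\mu=\int g\,\mathrm{d}\nu$ for all $g\in\mathcal{G}$. $\operatorname{span}_1(\mathcal{G})$ is the set of $y_0+\sum_{j=1}^ky_jg_j$ ($k\in\mathbb{N}_0$, $y_j\in\mathbb{R}$, $g_j\in\mathcal{G}$). Convex geometry: a convex $C'\subseteq C$ is a face of a convex set $C$ if $\lambda x_1+(1-\lambda)x_2\in C'$ with $0<\lambda<1$, $x_1,x_2\in C$ implies $x_1,x_2\in C'$; $x$ is an extreme point if $\{x\}$ is a face; $z$ is an extreme direction of $C$ if $\{x+\lambda z:\lambda\ge0\}$ is a face of $C$ for some $x\in C$. A polyhedron is a finite intersection of closed half-spaces. A polyhedral cover of $\mathcal{Y}$ is a finite collection $\mathfrak{C}$ of polyhedra in $\mathbb{R}^m$, each with at least one extreme point, with $\bigcup_{C\in\mathfrak{C}}C\supseteq\mathcal{Y}$, such that if $C_1,C_2\in\mathfrak{C}$ and $C_1\cap C_2\ne\emptyset$ then $C_1\cap C_2$ is a face of both. It is bounded if all members are bounded. For a polyhedron $C$ with an extreme point, $V(C)$ is its (finite)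 set of extreme points and $D(C)$ its (finite, possibly empty) set of extreme directions. $\mathfrak{F}(\mathfrak{C})$ is the set of non-empty faces of members of $\mathfrak{C}$, $V(\mathfrak{C}):=\bigcup_{C\in\mathfrak{C}}V(C)$, $D(\mathfrak{C}):=\bigcup_{C\in\mathfrak{C}}D(C)$, and $\eta(\mathfrak{C}):=\max_{C\in\mathfrak{C}}\max_{\boldsymbol{v},\boldsymbol{v}'\in V(C)}\|\boldsymbol{v}-\boldsymbol{v}'\|$. A vertex interpolation function set for $\mathfrak{C}$ is a family $\{g_{\boldsymbol{v}}:\bigcup_{C\in\mathfrak{C}}C\to\mathbb{R}\}_{\boldsymbol{v}\in V(\mathfrak{C})}$ with: (VIF1) $g_{\boldsymbol{v}}\ge0$; (VIF2) $g_{\boldsymbol{v}}(\boldsymbol{v}')=\mathbf{1}_{\{\boldsymbol{v}=\boldsymbol{v}'\}}$ for $\boldsymbol{v},\boldsymbol{v}'\in V(\mathfrak{C})$; (VIF3) $\sum_{\boldsymbol{v}\in V(F)}g_{\boldsymbol{v}}(\boldsymbol{x})=1$ for all $F\in\mathfrak{F}(\mathfrak{C})$, $\boldsymbol{x}\in F$; (VIF4) $g_{\boldsymbol{v}}(\boldsymbol{x})=0$ for all $F\in\mathfrak{F}(\mathfrak{C})$, $\boldsymbol{x}\in F$, $\boldsymbol{v}\in V(\mathfrak{C})\setminus V(F)$. When $\mathfrak{C}$ is unbounded, a $p$-radial function set is a family $\{\overline{g}_{\boldsymbol{u}}:\bigcup_{C\in\mathfrak{C}}C\to\mathbb{R}\}_{\boldsymbol{u}\in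 D(\mathfrak{C})}$ with (RF1) $\overline{g}_{\boldsymbol{u}}\ge0$ and (RF2) for every unbounded $F\in\mathfrak{F}(\mathfrak{C})$ and $\boldsymbol{x}\in F$: $(\min_{\boldsymbol{y}\in\operatorname{conv}(V(F))}\|\boldsymbol{x}-\boldsymbol{y}\|)^p\le\sum_{\boldsymbol{u}\in D(F)}\overline{g}_{\boldsymbol{u}}(\boldsymbol{x})$. For unbounded $\mathfrak{C}$, a set $\mathcal{G}$ of real functions on $\bigcup_{C\in\mathfrak{C}}C$ is a $p$-interpolation function set if $\operatorname{span}_1(\mathcal{G})$ contains a vertex interpolation function set and a $p$-radial function set; for bounded $\mathfrak{C}$, $\mathcal{G}$ is an interpolation function set if $\operatorname{span}_1(\mathcal{G})$ contains a vertex interpolation function set. *)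

(* Defs.v *)
From HB Require Import structures.
From mathcomp Require Import all_boot all_order all_algebra.
From mathcomp Require Import all_classical all_reals all_analysis.
Set Implicit Arguments.
Unset Strict Implicit.
Unset Printing Implicit Defensive.
Import Order.TTheory GRing.Theory Num.Theory.
Import numFieldNormedType.Exports.
Local Open Scope classical_set_scope.
Local Open Scope ring_scope.

Section Defs.
Variables (R : realType) (m : nat).
Local Notation V := 'rV[R]_m.

Definition is_norm (N : V -> R) : Prop :=
  [/\ forall x, N x = 0 -> x = 0,
      forall (a : R) x, N (a *: x) = `|a| * N x &
      forall x y, N (x + y) <= N x + N y].

Definition dotv (a x : V) : R := \sum_(i < m) a 0 i * x 0 i.

Definition polyhedron (C : set V) : Prop :=
  exists (n : nat) (A : 'I_n -> V) (b : 'I_n -> R),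
    (forall i, A i != 0) /\ C = [set x | forall i, dotv (A i) x <= b i].

Definition convex_set (C : set V) : Prop :=
  forall x y (l : R), C x -> C y -> 0 <= l <= 1 -> C (l *: x + (1 - l) *: y).

Definition face (C' C : set V) : Prop :=
  [/\ convex_set C', C' `<=` C &
      forall x1 x2 (l : R), 0 < l < 1 -> C x1 -> C x2 ->
        C' (l *: x1 + (1 - l) *: x2) -> C' x1 /\ C' x2].

Definition extreme_point (C : set V) (x : V) : Prop := face [set x] C.

Definition extreme_direction (C : set V) (z : V) : Prop :=
  exists2 x, C x & face [set x + l *: z | l in [set l : R | 0 <= l]] C.

Definition Vset (C : set V) : set V := [set x | extreme_point C x].

(** D(C): the (finite) set of extreme directions, each nonzero extreme
    direction being represented by its unique representative of N-norm 1. *)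
Definition Dset (N : V -> R) (C : set V) : set V :=
  [set z | extreme_direction C z /\ N z = 1].

Definition bounded_set (N : V -> R) (C : set V) : Prop :=
  exists M : R, forall x, C x -> N x <= M.

Definition polyhedral_cover (Y : set V) (k : nat) (C : 'I_k -> set V) : Prop :=
  [/\ forall i, polyhedron (C i),
      forall i, exists x, extreme_point (C i) x,
      Y `<=` \bigcup_i C i &
      forall i j, C i `&` C j !=set0 ->
        face (C i `&` C j) (C i) /\ face (C i `&` C j) (C j)].

Definition cover_bounded (N : V -> R) k (C : 'I_k -> set V) : Prop :=
  forall i, bounded_set N (C i).

Definition faces k (C : 'I_k -> set V) : set (set V) :=
  [set F | F !=set0 /\ exists i, face F (C i)].

Definition Vcover k (C : 'I_k -> set V) : set V := \bigcup_i Vset (C i).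
Definition Dcover (N : V -> R) k (C : 'I_k -> set V) : set V :=
  \bigcup_i Dset N (C i).

Definition mesh (N : V -> R) k (C : 'I_k -> set V) : R :=
  sup [set d | exists i v w, Vset (C i) v /\ Vset (C i) w /\ d = N (v - w)].

Definition conv (S : set V) : set V :=
  [set y | exists (n : nat) (w : 'I_n -> R) (pts : 'I_n -> V),
     [/\ forall j, 0 <= w j, \sum_(j < n) w j = 1, forall j, S (pts j) &
         y = \sum_(j < n) w j *: pts j]].

Definition span1 (U : set V) (G : set (V -> R)) (f : V -> R) : Prop :=
  exists (n : nat) (y0 : R) (y : 'I_n -> R) (g : 'I_n -> V -> R),
    (forall j, G (g j)) /\
    forall x, U x -> f x = y0 + \sum_(j < n) y j * g j x.

Definition vertex_interpolation k (C : 'I_k -> set V) (g : V -> V -> R) : Prop :=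
  let U := \bigcup_i C i in
  [/\ forall v x, Vcover C v -> U x -> 0 <= g v x,
      forall v v', Vcover C v -> Vcover C v' -> g v v' = (v == v')%:R,
      forall F x, faces C F -> F x -> \sum_(v \in Vset F) g v x = 1 &
      forall F x v, faces C F -> F x -> Vcover C v -> ~ Vset F v -> g v x = 0].

Definition p_radial (N : V -> R) (p : R) k (C : 'I_k -> set V)
    (gb : V -> V -> R) : Prop :=
  let U := \bigcup_i C i in
  (forall u x, Dcover N C u -> U x -> 0 <= gb u x) /\
  (forall F x, faces C F -> ~ bounded_set N F -> F x ->
     (inf [set N (x - y) | y in conv (Vset F)]) `^ p
       <= \sum_(u \in Dset N F) gb u x).

Definition interpolation_set k (C : 'I_k -> set V) (G : set (V -> R)) : Prop :=
  exists g, vertex_interpolation C g /\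
    forall v, Vcover C v -> span1 (\bigcup_i C i) G (g v).

Definition p_interpolation_set (N : V -> R) (p : R) k (C : 'I_k -> set V)
    (G : set (V -> R)) : Prop :=
  interpolation_set C G /\
  exists gb, p_radial N p C gb /\
    forall u, Dcover N C u -> span1 (\bigcup_i C i) G (gb u).

Definition borelV : Type := g_sigma_algebraType (@open V).

End Defs.

Local Open Scope ereal_scope.

Section Measures.
Variables (R : realType) (m : nat).
Local Notation V := 'rV[R]_m.
Local Notation T := (borelV R m).

Definition Pp (N : V -> R) (p : R) (Y : set V) (mu : probability T R) : Prop :=
  mu (~` Y) = 0 /\ \int[mu]_x ((N x) `^ p)%:E < +oo.

Definition in_Lp (p : R) (Y : set V) (mu : probability T R) (g : V -> R) : Prop :=
  measurable_fun (Y : set T) g /\ \int[mu]_(x in (Y : set T)) ((`|g x|) `^ p)%:E < +oo.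

Definition Pp_G N p Y (G : set (V -> R)) (mu : probability T R) : Prop :=
  Pp N p Y mu /\ forall g, G g -> in_Lp p Y mu g.

Definition G_equiv (Y : set V) (G : set (V -> R)) (mu nu : probability T R) : Prop :=
  forall g, G g -> \int[mu]_(x in (Y : set T)) (g x)%:E = \int[nu]_(x in (Y : set T)) (g x)%:E.

Definition coupling (mu nu : probability T R) (gam : probability (T * T)%type R) : Prop :=
  forall A : set T, measurable A ->
    gam (fst @^-1` A) = mu A /\ gam (snd @^-1` A) = nu A.

Definition Wp (N : V -> R) (p : R) (mu nu : probability T R) : \bar R :=
  (ereal_inf [set \int[gam]_z ((N ((z.1 : V) - (z.2 : V))) `^ p)%:E
             | gam in coupling mu nu]) `^ p^-1.

End Measures.

(* Main.v *)
Require Import Defs.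
From HB Require Import structures.
From mathcomp Require Import all_boot all_order all_algebra.
From mathcomp Require Import all_classical all_reals all_analysis.
From mathcomp Require Import measurable_realfun.
From mathcomp Require Import ring lra.
Set Implicit Arguments.
Unset Strict Implicit.
Unset Printing Implicit Defensive.
Import Order.TTheory GRing.Theory Num.Theory.
Import numFieldNormedType.Exports.
Local Open Scope classical_set_scope.
Local Open Scope ring_scope.

(** The vertex functions [g_v] form a partition of unity on [Y] whose integrals
    [w_v] agree for [mu] and [nu], so the sum over [v] of
    [w_v^-1 (g_v mu) x (g_v nu)] couples [mu] and [nu]. Almost every pair [(x, y)]
    under this coupling shares a vertex [v] with [g_v x <> 0] and [g_v y <> 0],
    hence each point lies in a cell having [v] among its vertices and is within
    [mesh] of [v], up to its distance to the hull of the vertices of that cell.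
    That distance vanishes on a bounded cell and is controlled by the radial
    functions on an unbounded one; only the maximal faces (the cells) matter. *)

(** * Polyhedra *)

Section Norm.
Context (R : realType) (m : nat) (N : 'rV[R]_m -> R).
Hypothesis Nn : is_norm N.

Lemma is_norm0 : N 0 = 0.
Proof. by case: Nn => _ NZ _; rewrite -(scale0r 0) NZ normr0 mul0r. Qed.

Lemma is_normN x : N (- x) = N x.
Proof. by case: Nn => _ NZ _; rewrite -scaleN1r NZ normrN1 mul1r. Qed.

Lemma is_norm_distC x y : N (x - y) = N (y - x).
Proof. by rewrite -is_normN opprB. Qed.

Lemma is_norm_ge0 x : 0 <= N x.
Proof.
have [_ _ /(_ x (- x))] := Nn.
by rewrite subrr is_norm0 is_normN -mulr2n pmulrn_lge0.
Qed.

Lemma is_norm_triangle z x y : N (x - y) <= N (x - z) + N (z - y).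
Proof. by case: Nn => _ _ ND; rewrite -(subrKA z x (- y)) ND. Qed.

Lemma is_norm_comb a b x y : 0 <= a -> 0 <= b ->
  N (a *: x + b *: y) <= a * N x + b * N y.
Proof.
move=> a0 b0; case: Nn => _ NZ ND.
by rewrite (le_trans (ND _ _))// !NZ !ger0_norm.
Qed.

End Norm.

Section Dotv.
Context (R : realType) (m : nat).
Implicit Types a x y : 'rV[R]_m.

Lemma dotvD a x y : dotv a (x + y) = dotv a x + dotv a y.
Proof.
by rewrite /dotv -big_split/=; apply: eq_bigr => i _; rewrite mxE mulrDr.
Qed.

Lemma dotvZ a t x : dotv a (t *: x) = t * dotv a x.
Proof.
by rewrite /dotv mulr_sumr; apply: eq_bigr => i _; rewrite mxE mulrCA.
Qed.

Lemma dotvN a x : dotv a (- x) = - dotv a x.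
Proof. by rewrite -scaleN1r dotvZ mulN1r. Qed.

End Dotv.

(** Midpoint identity in the shape [l *: _ + (1 - l) *: _] that [face] tests, at [l = 2^-1]. *)
Lemma midpointDB (R : realFieldType) (V : lmodType R) (x d : V) :
  2^-1 *: (x + d) + (1 - 2^-1) *: (x - d) = x.
Proof.
rewrite (_ : 1 - 2^-1 = 2^-1 :> R); last by lra.
by rewrite -scalerDr addrACA subrr addr0 scalerDr -scalerDl -[in LHS](mul1r 2^-1) -splitr scale1r.
Qed.

(** Choosing one element of [A] per label covers [A], since a label determines its element. Labels
    are given by a relation because the label of an extreme direction depends on the base point of
    its ray. *)
Lemma finite_set_functional_rel (T : choiceType) (I : finType) (r : T -> I -> Prop)
    (A : set T) :
  (forall x, A x -> exists i, r x i) ->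
  (forall x y i, A x -> A y -> r x i -> r y i -> x = y) -> finite_set A.
Proof.
move=> rex runiq.
have [->//|/set0P[x0 _]] := eqVneq A set0.
pose h i := xget x0 [set x | A x /\ r x i].
apply: (@sub_finite_set _ _ (h @` [set: I])); last exact/finite_image/finite_finset.
move=> x Ax; have [i rxi] := rex _ Ax; exists i => //.
rewrite /h; case: xgetP => [y _ [Ay ryi]|/(_ x)]; first exact: (runiq _ _ i).
by move/not_andP => [].
Qed.

Section Polyhedron.
Context (R : realType) (m n : nat) (A : 'I_n -> 'rV[R]_m) (b : 'I_n -> R).
Local Notation P := [set x : 'rV[R]_m | forall i, dotv (A i) x <= b i].

(** Constraints tight at [x]. For [x] in [P] they determine the smallest face containing [x], so
    this finite datum can label extreme points and extreme rays. *)
Definition active (x : 'rV[R]_m) : {set 'I_n} := [set i | dotv (A i) x == b i]%SET.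

(** Tight constraints do not change along [d], and each remaining one has positive slack that a
    short step cannot exhaust. *)
Lemma polyhedron_step x d : P x -> (forall i, i \in active x -> dotv (A i) d = 0) ->
  exists2 e, 0 < e & P (x + e *: d) /\ P (x + e *: - d).
Proof.
move=> Px dact.
(* Admissible step for constraint [i]: its slack over its rate of change, with [1 +] keeping the
   denominator positive. The value for tight constraints is arbitrary positive. *)
pose f i := if i \in active x then 1
            else (b i - dotv (A i) x) / (1 + `|dotv (A i) d|).
have f0 i : 0 < f i.
  rewrite /f; case: ifPn => // iact; rewrite divr_gt0// subr_gt0.
  by rewrite lt_neqAle Px andbT; move: iact; rewrite inE.
exists (\big[Order.min/1]_i f i).
  by elim/big_ind : _ => // y z y0 z0; rewrite lt_min y0.
suff H s : `|s| = 1 -> P (x + (\big[Order.min/1]_i f i) *: (s *: d)).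
  split; first by have := H 1; rewrite scale1r normr1; exact.
  by have := H (-1); rewrite scaleN1r normrN1; exact.
move=> s1 i /=; rewrite dotvD !dotvZ.
have [iact|iact] := boolP (i \in active x).
  by rewrite dact// !mulr0 addr0; exact: Px.
set e := \big[_/_]_j _.
have e0 : 0 <= e by rewrite /e; elim/big_ind : _ => // [y z y0 z0|j _];
  [rewrite le_min y0|exact/ltW].
have ef : e <= f i by exact: bigmin_le_cond.
rewrite -lerBrDl (le_trans (ler_norm _))// !normrM s1 mul1r ger0_norm//.
rewrite (le_trans (ler_wpM2r _ ef))// /f (negbTE iact).
rewrite -mulrA ler_piMr//; first by rewrite subr_ge0; exact: Px.
by rewrite mulrC ler_pdivrMr ?mul1r ?lerDr// (lt_le_trans ltr01)// lerDl.
Qed.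

(** A proper average of two numbers that are at most [b i] equals [b i] only if both do, so a
    constraint tight inside the segment is tight at both endpoints. *)
Lemma active_comb x1 x2 (l : R) : 0 < l < 1 -> P x1 -> P x2 ->
  forall i, i \in active (l *: x1 + (1 - l) *: x2) -> dotv (A i) (x1 - x2) = 0.
Proof.
move=> /andP[l0 l1] Px1 Px2 i; rewrite inE !dotvD !dotvZ dotvN => /eqP act.
have := Px1 i; have := Px2 i; nra.
Qed.

(** The constraints tight at [x] vanish on [y - x], so [x] is the midpoint of two points
    [x + e *: (y - x)] and [x - e *: (y - x)] of [P]; extremality collapses them. *)
Lemma extreme_point_active x y : extreme_point P x -> extreme_point P y ->
  active x = active y -> x = y.
Proof.
move=> [_ xP xext] [_ yP _] axy.
have Px : P x by exact: xP.
have Py : P y by exact: yP.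
have [|e e0 [Pp Pm]] := @polyhedron_step x (y - x) Px.
  move=> i iact; rewrite dotvD dotvN; have := iact; rewrite axy inE => /eqP ->.
  by move: iact; rewrite inE => /eqP ->; rewrite subrr.
have [||/= e1 _] := xext _ _ (2^-1) _ Pp Pm.
- by apply/andP; split; lra.
- by rewrite scalerN midpointDB.
move: e1 => /(canRL (addKr _)); rewrite addNr => /eqP.
by rewrite scaler_eq0 gt_eqF//= subr_eq0 => /eqP.
Qed.

Lemma polyhedron_recession x z : (forall l : R, 0 <= l -> P (x + l *: z)) ->
  forall i, dotv (A i) z <= 0.
Proof.
move=> ray i; rewrite leNgt; apply/negP => zi.
(* At this multiple of [z] the constraint would take the value [b i + 1]. *)
have l0 : 0 <= (b i - dotv (A i) x + 1) / dotv (A i) z.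
  have := ray 0 (lexx _) i; rewrite scale0r addr0 => xi.
  by rewrite divr_ge0 ?(ltW zi)// addr_ge0// subr_ge0.
have := ray _ l0 i; rewrite dotvD dotvZ divfK ?gt_eqF//; lra.
Qed.

Context (N : 'rV[R]_m -> R).
Hypothesis Nn : is_norm N.

(** The label is read at [x + z], inside the ray, because more constraints may be tight at its
    endpoint [x]. Moving from [x + z] by small multiples of [z'] stays in [P], hence on the first
    ray, so [z'] is a multiple of [z]; the norms leave only the sign to decide. *)
Lemma extreme_ray_active x z x' z' :
    face [set x + l *: z | l in [set l : R | 0 <= l]] P ->
    face [set x' + l *: z' | l in [set l : R | 0 <= l]] P ->
    N z = 1 -> N z' = 1 -> active (x + z) = active (x' + z') ->
  z = z'.
Proof.
move=> [_ sP ext] [_ s'P _] Nz Nz' azz'.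
have ray l : 0 <= l -> P (x + l *: z) by move=> l0; apply: sP; exists l.
have ray' l : 0 <= l -> P (x' + l *: z') by move=> l0; apply: s'P; exists l.
(* The point [x' + z'] lies between the points of parameter 0 and 2 of its ray; a constraint tight
   there and satisfied at both is constant along the ray. *)
have z'act i : i \in active (x + z) -> dotv (A i) z' = 0.
  rewrite azz' inE dotvD => /eqP act.
  have := ray' 0 (lexx _) i; have := ray' 2 (ler0n _ _) i.
  by rewrite !dotvD !dotvZ => ? ?; lra.
have Pq : P (x + z) by have := ray 1 ler01; rewrite scale1r.
have [e e0 [Pp Pm]] := polyhedron_step Pq z'act.
have [||[l /= l0 le] _] := ext _ _ (2^-1) _ Pp Pm.
- by apply/andP; split; lra.
- by exists 1 => //=; rewrite scalerN midpointDB scale1r.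
have z'E : z' = ((l - 1) / e) *: z.
  apply: (@scalerI _ _ e); first by rewrite gt_eqF.
  rewrite scalerA mulrC divfK ?gt_eqF// scalerBl scale1r.
  apply: (@addrI _ (x + z)); rewrite -le -addrA; congr (_ + _).
  by rewrite addrC subrK.
have [z0 NZ _] := Nn.
have : `|(l - 1) / e| = 1 by have := Nz'; rewrite z'E NZ Nz mulr1.
move=> /eqP; rewrite eqr_norml// ler01 andbT => /orP[|] /eqP c.
  by rewrite z'E c scale1r.
(* Remaining case [z' = - z]: then [- z] is a recession direction, [x] is the midpoint of [x + z]
   and [x - z], and the face property would put [x - z] on the ray. *)
have Pxm : P (x + -1 *: z).
  move=> i /=; rewrite dotvD dotvZ.
  have := polyhedron_recession ray' i; rewrite z'E c dotvZ.
  have := ray 0 (lexx _) i; rewrite scale0r addr0; lra.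
have [||_ [t /= t0 /addrI/eqP]] := ext _ _ (2^-1) _ (ray 1 ler01) Pxm.
- by apply/andP; split; lra.
- by exists 0 => //=; rewrite scaleN1r scale1r midpointDB scale0r addr0.
rewrite -subr_eq0 -scalerBl scaler_eq0 => /orP[/eqP t1|/eqP z00]; first by exfalso; lra.
by move: Nz; rewrite z00 (is_norm0 Nn) => /esym/eqP; rewrite oner_eq0.
Qed.

(** Ratio test: boundedness makes some constraint increase along [d]; stopping at the first one
    reached makes it tight, while the constraints already tight stay so. *)
Lemma exit_polyhedron x d M : (forall x, P x -> N x <= M) -> P x -> d != 0 ->
    (forall i, i \in active x -> dotv (A i) d = 0) ->
  exists2 t, 0 < t & P (x + t *: d) /\ active x \proper active (x + t *: d).
Proof.
move=> PM Px d0 dact.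
have [N0 NZ ND] := Nn.
have Nd : 0 < N d.
  rewrite lt_neqAle (is_norm_ge0 Nn) andbT eq_sym.
  by apply: contra d0 => /eqP/N0/eqP.
have [i0 i0d] : exists i, 0 < dotv (A i) d.
  apply: contrapT => /forallNP nd.
  have Pt t : 0 <= t -> P (x + t *: d).
    move=> t0 i /=; rewrite dotvD dotvZ (le_trans _ (Px i))// gerDl.
    by rewrite mulr_ge0_le0// leNgt; exact/negP/nd.
  have M0 : 0 <= M by rewrite (le_trans _ (PM _ Px))// (is_norm_ge0 Nn).
  (* By the triangle inequality, the point at this parameter has norm at least [M + 1]. *)
  have t0 : 0 <= (M + N x + 1) / N d.
    by rewrite divr_ge0 ?(ltW Nd)// !addr_ge0// (is_norm_ge0 Nn).
  have := PM _ (Pt _ t0).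
  have := is_norm_triangle Nn (- x) ((M + N x + 1) / N d *: d) 0.
  rewrite !subr0 opprK (is_normN Nn) NZ ger0_norm// divfK ?gt_eqF// addrC.
  by rewrite [_ + x]addrC; lra.
pose f i := (b i - dotv (A i) x) / dotv (A i) d.
case: (@Order.TotalTheory.arg_minP _ _ _ i0 (fun i => 0 < dotv (A i) d) f i0d) => i id imin.
have fi0 : 0 < f i.
  rewrite divr_gt0// subr_gt0 lt_neqAle Px andbT.
  by apply/negP => iact; move: id; rewrite dact ?inE// ltxx.
exists (f i) => //; split.
  move=> j /=; rewrite dotvD dotvZ -lerBrDl.
  have [jd|jd] := leP (dotv (A j) d) 0.
    apply: (@le_trans _ _ 0); last by rewrite subr_ge0; exact: Px.
    by rewrite mulr_ge0_le0// ltW.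
  by rewrite -ler_pdivlMr// imin.
apply/properP; split.
  apply/fintype.subsetP => j jact; rewrite inE dotvD dotvZ dact// mulr0 addr0.
  by move: jact; rewrite inE.
exists i; first by rewrite inE dotvD dotvZ /f divfK ?(gt_eqF id)// addrC subrK.
by apply/negP => iact; move: id; rewrite dact ?ltxx.
Qed.

(* A non-extreme point lies strictly inside a segment whose endpoints saturate
   more constraints; iterate on the number of inactive constraints. *)
Lemma bounded_polyhedron_vertex_bound M M' v : (forall x, P x -> N x <= M) ->
  (forall w, extreme_point P w -> N (w - v) <= M') ->
  forall x, P x -> N (x - v) <= M'.
Proof.
move=> PM Pext x; have [k] := ubnP #|~: active x|.
elim: k x => // k IH x; rewrite ltnS => xk Px.
have [/Pext//|nx] := pselect (extreme_point P x).
have [x1 [x2 [l [l01 Px1 Px2 xE x12]]]] : exists x1 x2 l,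
    [/\ 0 < l < 1, P x1, P x2, x = l *: x1 + (1 - l) *: x2 & x1 != x2].
  apply: contrapT => H; apply: nx; split.
  - move=> y z l -> -> _ /=; rewrite -scalerDl addrC subrK scale1r//.
  - by move=> y ->.
  - move=> x1 x2 l l01 Px1 Px2 /= xE.
    have [x12|x12] := eqVneq x1 x2; last first.
      by exfalso; apply: H; exists x1, x2, l; split.
    by move: xE; rewrite x12 -scalerDl addrC subrK scale1r.
have dact i : i \in active x -> dotv (A i) (x1 - x2) = 0.
  by rewrite xE; exact: active_comb.
have dact' i : i \in active x -> dotv (A i) (- (x1 - x2)) = 0.
  by move=> /dact; rewrite dotvN => ->; rewrite oppr0.
have d0 : x1 - x2 != 0 by rewrite subr_eq0.
have [|t t0 [Pt actt]] := exit_polyhedron PM Px _ dact; first by [].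
have [|s s0 [Ps acts]] := exit_polyhedron PM Px _ dact'; first by rewrite oppr_eq0.
have inact y : active x \proper active y -> (#|~: active y| < k)%N.
  by move=> xy; apply: leq_trans xk; rewrite proper_card// finset.properC.
have {}Pt := IH _ (inact _ actt) Pt.
have {}Ps := IH _ (inact _ acts) Ps.
set d := x1 - x2 in Pt Ps.
have st0 : s + t != 0 by rewrite gt_eqF// addr_gt0.
(* [x] sits at parameter distance [t] from one exit point and [s] from the other, whence the
   weights; convexity of the norm concludes. *)
have -> : x - v = (s / (s + t)) *: (x + t *: d - v)
                  + (t / (s + t)) *: (x + s *: - d - v).
  by apply/rowP => i; rewrite !mxE; field.
apply: le_trans (is_norm_comb Nn _ _ _ _) _; [by rewrite divr_ge0// ltW// addr_gt0..|].
apply: (@le_trans _ _ (s / (s + t) * M' + t / (s + t) * M')).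
  by rewrite lerD// ler_wpM2l// divr_ge0// ltW// addr_gt0.
by rewrite -mulrDl -mulrDl divff// mul1r.
Qed.

End Polyhedron.

Section PolyhedronFinite.
Context (R : realType) (m : nat).

Lemma finite_Vset (C : set 'rV[R]_m) : polyhedron C -> finite_set (Vset C).
Proof.
move=> [n [A [b [_ ->]]]].
apply: (@finite_set_functional_rel _ _ (fun x s => active A b x = s)).
  by move=> x _; eexists.
by move=> x y s Vx Vy <- /esym; exact: extreme_point_active.
Qed.

Lemma finite_Dset (N : 'rV[R]_m -> R) (C : set 'rV[R]_m) : is_norm N ->
  polyhedron C -> finite_set (Dset N C).
Proof.
move=> Nn [n [A [b [_ ->]]]].
set P := [set x | _].
apply: (@finite_set_functional_rel _ _ (fun z s => exists2 x,
  face [set x + l *: z | l in [set l : R | 0 <= l]] P & active A b (x + z) = s)).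
  by move=> z [[x _ fx] _]; exists (active A b (x + z)), x.
move=> z z' s [_ Nz] [_ Nz'] [x fx <-] [x' fx' /esym].
exact: (extreme_ray_active Nn fx fx' Nz Nz').
Qed.

Lemma polyhedron_convex (C : set 'rV[R]_m) : polyhedron C -> Defs.convex_set C.
Proof.
move=> [n [A [b [_ ->]]]] x y l Px Py /andP[l0 l1] i /=; rewrite dotvD !dotvZ.
have := Px i; have := Py i; nra.
Qed.

Lemma face_refl (C : set 'rV[R]_m) : Defs.convex_set C -> face C C.
Proof. by split. Qed.

End PolyhedronFinite.

(** * Gluing along a partition of unity *)

Section ProductIntegral.
Context d1 d2 (T1 : measurableType d1) (T2 : measurableType d2) (R : realType).
Context (mu : probability T1 R) (nu : probability T2 R).
Variables (F : T1 -> R) (G : T2 -> R).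
Hypotheses (mF : measurable_fun setT F) (mG : measurable_fun setT G).
Hypotheses (F0 : forall x, 0 <= F x) (G0 : forall y, 0 <= G y).
Local Open Scope ereal_scope.

Lemma measurable_fun_tensor :
  measurable_fun [set: T1 * T2] (fun z => (F z.1 * G z.2)%R).
Proof.
by apply: measurable_funM; [exact: (measurableT_comp mF)|exact: (measurableT_comp mG)].
Qed.

Lemma integral_tensor : \int[mu \x nu]_z (F z.1 * G z.2)%:E =
  (\int[mu]_x (F x)%:E) * (\int[nu]_y (G y)%:E).
Proof.
rewrite fubini_tonelli1; last 2 first.
- by apply/measurable_EFinP; exact: measurable_fun_tensor.
- by move=> z; rewrite lee_fin mulr_ge0.
under eq_integral => x _.
  rewrite /fubini_F/=; under eq_integral do rewrite EFinM.
  rewrite ge0_integralZl_EFin//; last 2 first.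
  - by move=> y _; rewrite lee_fin.
  - exact/measurable_EFinP.
  over.
rewrite ge0_integralZr//.
- exact/measurable_EFinP.
- by move=> x _; rewrite lee_fin.
- by apply: integral_ge0 => y _; rewrite lee_fin.
Qed.

End ProductIntegral.

Lemma integral_tensor_setX d1 d2 (T1 : measurableType d1) (T2 : measurableType d2)
    (R : realType) (mu : probability T1 R) (nu : probability T2 R)
    (F : T1 -> R) (G : T2 -> R) (A : set T1) (B : set T2) :
  measurable_fun setT F -> measurable_fun setT G ->
  (forall x, 0 <= F x) -> (forall y, 0 <= G y) -> measurable A -> measurable B ->
  (\int[mu \x nu]_(z in A `*` B) (F z.1 * G z.2)%:E =
   (\int[mu]_(x in A) (F x)%:E) * (\int[nu]_(y in B) (G y)%:E))%E.
Proof.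
move=> mF mG F0 G0 mA mB.
have mkcond d (T : measurableType d) (m : {measure set T -> \bar R}) D k :
    (\int[m]_(x in D) (k x)%:E = \int[m]_x ((k \_ D) x)%:E)%E.
  by rewrite integral_mkcond; apply: eq_integral => x _; rewrite !patchE; case: ifP.
rewrite (mkcond _ _ _ A) (mkcond _ _ _ B) (mkcond _ _ _ (A `*` B)) -integral_tensor; last 4 first.
- by apply: (measurable_restrictT _ mA).1; exact: measurable_funTS.
- by apply: (measurable_restrictT _ mB).1; exact: measurable_funTS.
- by move=> x; rewrite patchE; case: ifPn.
- by move=> x; rewrite patchE; case: ifPn.
apply: eq_integral => -[x y] _; rewrite !patchE in_setX/=.
by case: (x \in A); case: (y \in B); rewrite ?mul0r ?mulr0.
Qed.

Section GluedCoupling.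
Context d1 d2 (T1 : measurableType d1) (T2 : measurableType d2) (R : realType).
Context (mu : probability T1 R) (nu : probability T2 R).
Variables (I : eqType) (s : seq I) (f : I -> T1 -> R) (g : I -> T2 -> R) (w : I -> R).
Hypotheses (mf : forall i, measurable_fun setT (f i))
           (mg : forall i, measurable_fun setT (g i)).
Hypotheses (f0 : forall i x, 0 <= f i x) (g0 : forall i y, 0 <= g i y).
Hypothesis fw : forall i, (\int[mu]_x (f i x)%:E = (w i)%:E)%E.
Hypothesis gw : forall i, (\int[nu]_y (g i y)%:E = (w i)%:E)%E.
Hypothesis f1 : {ae mu, forall x, \sum_(i <- s) f i x = 1}.
Hypothesis g1 : {ae nu, forall y, \sum_(i <- s) g i y = 1}.
Local Open Scope ereal_scope.

(** Density of the coupling with respect to [mu \x nu]. An index with [w i = 0] drops out since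
    [0^-1 = 0]; its functions have integral 0, so no mass is lost. *)
Let h (z : T1 * T2) : R := (\sum_(i <- s) (w i)^-1 * (f i z.1 * g i z.2))%R.

Let w0 i : (0 <= w i)%R.
Proof. by rewrite -lee_fin -fw integral_ge0// => x _; rewrite lee_fin. Qed.

Let h0 z : (0 <= h z)%R.
Proof.
by apply: sumr_ge0 => i _; rewrite mulr_ge0 ?invr_ge0 ?w0// mulr_ge0.
Qed.

Let mh : measurable_fun setT h.
Proof.
apply: measurable_sum => i; apply: measurable_funM => //.
exact: measurable_fun_tensor.
Qed.

Let gam (A : set (T1 * T2)) : \bar R := \int[mu \x nu]_(z in A) (h z)%:E.

Let gam0 : gam set0 = 0. Proof. by rewrite /gam integral_set0. Qed.

Let gam_ge0 A : 0 <= gam A.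
Proof. by apply: integral_ge0 => z _; rewrite lee_fin. Qed.

Let gam_sigma_additive : semi_sigma_additive gam.
Proof.
move=> F mF tF mUF; rewrite /gam ge0_integral_bigcup//.
- by apply: is_cvg_ereal_nneg_natsum_cond => n _ _; exact: gam_ge0.
- by apply/measurable_EFinP; exact: measurable_funTS.
- by move=> z _; rewrite lee_fin.
Qed.

HB.instance Definition _ := isMeasure.Build _ _ _ gam
  gam0 gam_ge0 gam_sigma_additive.

Let gam_setX A B : measurable A -> measurable B ->
  gam (A `*` B) = \sum_(i <- s) (w i)^-1%:E *
    ((\int[mu]_(x in A) (f i x)%:E) * (\int[nu]_(y in B) (g i y)%:E)).
Proof.
move=> mA mB; rewrite /gam /h.
under eq_integral do rewrite -sumEFin.
have mAB : measurable (A `*` B) by exact: measurableX.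
rewrite ge0_integral_sum//; last 2 first.
- move=> i; apply/measurable_EFinP/measurable_funTS/measurable_funM => //.
  exact: measurable_fun_tensor.
- by move=> i z _; rewrite lee_fin mulr_ge0 ?invr_ge0 ?w0// mulr_ge0.
apply: eq_bigr => i _; under eq_integral do rewrite EFinM.
rewrite ge0_integralZl_EFin ?invr_ge0 ?w0//; last 2 first.
- by move=> z _; rewrite lee_fin mulr_ge0.
- by apply/measurable_EFinP/measurable_funTS; exact: measurable_fun_tensor.
by rewrite integral_tensor_setX.
Qed.

(** The case [w i = 0] is the delicate one: the left side is 0, and so is the right, being at most
    the integral of [k i] over the whole space. *)
Let weightK d (T : measurableType d) (m : {measure set T -> \bar R})
    (k : I -> T -> R) (A : set T) i : measurable A ->
    (forall i, measurable_fun setT (k i)) -> (forall i x, (0 <= k i x)%R) ->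
    \int[m]_x (k i x)%:E = (w i)%:E ->
  (w i)^-1%:E * (\int[m]_(x in A) (k i x)%:E * (w i)%:E) = \int[m]_(x in A) (k i x)%:E.
Proof.
move=> mA mk k0 kw; rewrite muleCA -EFinM.
have [wi|wi] := eqVneq (w i) 0%R; last by rewrite mulVf// mule1.
rewrite wi mulr0 mule0; apply/esym/eqP; rewrite eq_le; apply/andP; split.
  rewrite -[leRHS]/(0%:E) -wi -kw; apply: ge0_subset_integral => //.
    exact/measurable_EFinP.
  by move=> x _; rewrite lee_fin.
by apply: integral_ge0 => x _; rewrite lee_fin.
Qed.

Let partition_measure d (T : measurableType d) (m : {measure set T -> \bar R})
    (k : I -> T -> R) (A : set T) : measurable A ->
    (forall i, measurable_fun setT (k i)) -> (forall i x, (0 <= k i x)%R) ->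
    {ae m, forall x, (\sum_(i <- s) k i x)%R = 1%R} ->
  \sum_(i <- s) \int[m]_(x in A) (k i x)%:E = m A.
Proof.
move=> mA mk k0 k1; rewrite -ge0_integral_sum//; last 2 first.
- by move=> i; apply/measurable_EFinP/measurable_funTS.
- by move=> i x _; rewrite lee_fin.
under eq_integral do rewrite sumEFin.
rewrite -[RHS]mul1e -integral_cst//; apply: ae_eq_integral => //.
- by apply/measurable_EFinP/measurable_funTS/measurable_sum.
- by apply: filterS k1 => x /= -> _.
Qed.

Let gam_fst A : measurable A -> gam (fst @^-1` A) = mu A.
Proof.
move=> mA; have -> : fst @^-1` A = A `*` [set: T2] by rewrite setXT.
rewrite gam_setX//.
by under eq_bigr do rewrite gw weightK//; exact: partition_measure.
Qed.

Let gam_snd B : measurable B -> gam (snd @^-1` B) = nu B.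
Proof.
move=> mB; have -> : snd @^-1` B = [set: T1] `*` B by rewrite setTX.
rewrite gam_setX//.
under eq_bigr do rewrite fw (muleC (w _)%:E) weightK//.
exact: partition_measure.
Qed.

Let gam_setT : gam setT = 1.
Proof. by have := gam_fst measurableT; rewrite preimage_setT probability_setT. Qed.

HB.instance Definition _ := Measure_isProbability.Build _ _ _ gam gam_setT.

Lemma glued_coupling : exists gam : probability (T1 * T2)%type R,
  [/\ forall A, measurable A -> gam (fst @^-1` A) = mu A,
      forall B, measurable B -> gam (snd @^-1` B) = nu B &
      exists Z, [/\ measurable Z, gam Z = 0 & forall z, ~ Z z ->
        exists2 i, i \in s & f i z.1 != 0%R /\ g i z.2 != 0%R]].
Proof.
(* The null set is the zero set of the density; off it some summand is nonzero, hence so are both of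
   its factors. *)
exists gam; split => //; exists (h @^-1` [set 0%R]); split.
- by rewrite -[_ @^-1` _]setTI; exact: mh.
- by rewrite /= /gam; apply: integral0_eq => z ->.
- move=> z hz; apply: contrapT => nex; apply: hz.
  rewrite /= /h big_seq big1// => i si; apply/eqP; rewrite mulf_eq0 mulf_eq0.
  apply/or3P; case: (eqVneq (f i z.1) 0%R) => [|fi]; first by constructor 2.
  case: (eqVneq (g i z.2) 0%R) => [|gi]; first by constructor 3.
  by exfalso; apply: nex; exists i.
Qed.

End GluedCoupling.

(** * Wasserstein bounds *)

Lemma powR_convex2 (R : realType) (p l x y : R) : 1 <= p -> 0 <= l <= 1 ->
  0 <= x -> 0 <= y ->
  (l * x + (1 - l) * y) `^ p <= l * x `^ p + (1 - l) * y `^ p.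
Proof.
move=> p1 /andP[l0 l1] x0 y0.
by apply: (convex_powR p1 (Itv01 l0 l1)); rewrite inE/= in_itv/= ?x0 ?y0.
Qed.

Lemma powRVK (R : realType) (p x : R) : 1 <= p -> 0 <= x -> (x `^ p^-1) `^ p = x.
Proof.
move=> p1 x0; rewrite -powRrM mulVf ?powRr1//.
by rewrite gt_eqF// (lt_le_trans ltr01).
Qed.

(* Jensen for [t |-> t^p] replaces Minkowski's inequality: after integration the
   right-hand side is at most [(M + 2 * c) `^ p] as soon as [x] and [y] have
   integrals at most [c `^ p]. *)
Lemma powR_affine_bound (R : realType) (p M c : R) : 1 <= p -> 0 <= M -> 0 < c ->
  exists al be : R, [/\ 0 <= al, 0 <= be,
    al + be * (c `^ p + c `^ p) = (M + 2 * c) `^ p &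
    forall x y, 0 <= x -> 0 <= y ->
      (M + x `^ p^-1 + y `^ p^-1) `^ p <= al + be * (x + y)].
Proof.
move=> p1 M0 c0; set K := M + 2 * c.
have K0 : 0 < K by rewrite /K; lra.
have cp0 : 0 < c `^ p by rewrite powR_gt0.
have Kp0 : 0 <= K `^ p by exact: powR_ge0.
set l := M / K.
have l01 : 0 <= l <= 1.
  by rewrite /l divr_ge0 ?(ltW K0)//= ler_pdivrMr// mul1r /K; lra.
have [l0 l1] := andP l01.
(* These come from writing [M + a + b] as [K] times the average of [1], [a / c] and [b / c] with
   weights [M / K], [c / K] and [c / K], then applying convexity twice. *)
exists (K `^ p * l), (K `^ p * ((1 - l) / 2) / c `^ p); split.
- by rewrite mulr_ge0.
- by rewrite divr_ge0 ?(ltW cp0)// mulr_ge0// divr_ge0// subr_ge0.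
- by field; rewrite gt_eqF.
move=> x y x0 y0.
set a := x `^ p^-1; set b := y `^ p^-1.
have a0 : 0 <= a by exact: powR_ge0.
have b0 : 0 <= b by exact: powR_ge0.
have divp t : 0 <= t -> (t `^ p^-1 / c) `^ p = t / c `^ p.
  move=> t0; have ci : c^-1 `^ p = (c `^ p)^-1.
    by rewrite -powR_inv1 ?(ltW c0)// -powRrM mulN1r powRN.
  by rewrite powRM ?powR_ge0 ?invr_ge0 ?(ltW c0)// powRVK// ci.
have -> : M + a + b = K * (l * 1 + (1 - l) * (2^-1 * (a / c) + (1 - 2^-1) * (b / c))).
  by rewrite /l /K; field; rewrite -/K !gt_eqF.
have ac0 : 0 <= a / c by rewrite divr_ge0// ltW.
have bc0 : 0 <= b / c by rewrite divr_ge0// ltW.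
have h01 : 0 <= (2^-1 : R) <= 1 by apply/andP; split; lra.
have q0 : 0 <= 2^-1 * (a / c) + (1 - 2^-1) * (b / c).
  by rewrite addr_ge0// mulr_ge0//; lra.
rewrite powRM ?(ltW K0)//; last by rewrite addr_ge0// mulr_ge0// subr_ge0.
have := powR_convex2 p1 h01 ac0 bc0; rewrite !divp// => h2.
have := powR_convex2 p1 l01 ler01 q0; rewrite powR1 => h3.
apply: (@le_trans _ _ (K `^ p * (l * 1 + (1 - l) *
    (2^-1 * (x / c `^ p) + (1 - 2^-1) * (y / c `^ p))))).
  rewrite ler_wpM2l// (le_trans h3)// lerD2l ler_wpM2l// subr_ge0//.
by rewrite le_eqVlt; apply/orP; left; apply/eqP; field; rewrite gt_eqF.
Qed.

(** A nonnegative integral is a supremum over the simple functions below the integrand, and that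
    family grows with the integrand. This allows bounding the transport cost without establishing
    its measurability. *)
Lemma le_integral_ge0 d (T : measurableType d) (R : realType)
    (mu : {measure set T -> \bar R}) (f g : T -> \bar R) :
  (forall x, 0 <= f x)%E -> (forall x, f x <= g x)%E ->
  (\int[mu]_x f x <= \int[mu]_x g x)%E.
Proof.
move=> f0 fg; rewrite !ge0_integralTE//; last by move=> x; exact: le_trans (fg x).
by apply: ereal_sup_le => _ [h hf <-]; exists h => // x; exact: le_trans (fg x).
Qed.

Section Wasserstein.
Context (R : realType) (m : nat).
Local Notation V := 'rV[R]_m.
Local Notation T := (borelV R m).
Variables (N : V -> R) (p : R).
Hypotheses (p1 : 1 <= p) (Nn : is_norm N).
Variables (mu nu : probability T R).

Lemma coupling_integral_fst (gam : probability (T * T)%type R) (r : T -> R) :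
  coupling mu nu gam -> measurable_fun setT r -> (forall x, 0 <= r x) ->
  (\int[gam]_z (r z.1)%:E = \int[mu]_x (r x)%:E)%E.
Proof.
move=> cg mr r0.
have := @ge0_integral_pushforward _ _ _ _ R _ (@measurable_fst _ _ T T) gam
  setT (EFin \o r) measurableT.
rewrite preimage_setT => <-.
- by apply: eq_measure_integral => A mA _; have [] := cg _ mA.
- exact/measurable_EFinP.
- by move=> x _; rewrite lee_fin.
Qed.

Lemma coupling_integral_snd (gam : probability (T * T)%type R) (r : T -> R) :
  coupling mu nu gam -> measurable_fun setT r -> (forall x, 0 <= r x) ->
  (\int[gam]_z (r z.2)%:E = \int[nu]_x (r x)%:E)%E.
Proof.
move=> cg mr r0.
have := @ge0_integral_pushforward _ _ _ _ R _ (@measurable_snd _ _ T T) gam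
  setT (EFin \o r) measurableT.
rewrite preimage_setT => <-.
- by apply: eq_measure_integral => A mA _; have [] := cg _ mA.
- exact/measurable_EFinP.
- by move=> x _; rewrite lee_fin.
Qed.

(** The affine bound of [powR_affine_bound] is integrated against [gam]; being a sum of functions of
    one coordinate, it only sees the marginals. *)
Lemma Wp_le_coupling (gam : probability (T * T)%type R) (Z : set (T * T))
    (r : T -> R) (M S : R) :
  coupling mu nu gam -> measurable Z -> gam Z = 0%E ->
  measurable_fun setT r -> (forall x, 0 <= r x) -> 0 <= M -> 0 <= S ->
  (\int[mu]_x (r x)%:E <= S%:E)%E -> (\int[nu]_x (r x)%:E <= S%:E)%E ->
  (forall z, ~ Z z ->
    N ((z.1 : V) - (z.2 : V)) <= M + r z.1 `^ p^-1 + r z.2 `^ p^-1) ->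
  (Wp N p mu nu <= (M + 2 * S `^ p^-1)%:E)%E.
Proof.
move=> cg mZ Z0 mr r0 M0 S0 muS nuS bnd.
have p0 : 0 < p by rewrite (lt_le_trans ltr01).
have ip0 : 0 <= p^-1 by rewrite invr_ge0 ltW.
suff H c : 0 < c -> S <= c `^ p -> (Wp N p mu nu <= (M + 2 * c)%:E)%E.
  apply/lee_addgt0Pr => e e0.
  have c0 : 0 < S `^ p^-1 + e / 2 by rewrite ltr_wpDl ?powR_ge0// divr_gt0.
  rewrite -EFinD (le_trans (H _ c0 _))//; last by rewrite lee_fin; lra.
  rewrite -[leLHS](powRVK p1)// ge0_ler_powR// ?nnegrE ?powR_ge0 ?(ltW p0)//.
    exact: ltW.
  by rewrite lerDl divr_ge0// ltW.
move=> c0 Sc.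
have [al [be [al0 be0 abE abP]]] := powR_affine_bound p1 M0 c0.
have cost0 (z : T * T) : (0 <= ((N ((z.1 : V) - (z.2 : V))) `^ p)%:E)%E.
  by rewrite lee_fin powR_ge0.
have K0 : 0 <= M + 2 * c by rewrite addr_ge0// mulr_ge0// ltW.
suff costK : (\int[gam]_z ((N ((z.1 : V) - (z.2 : V))) `^ p)%:E <=
              ((M + 2 * c) `^ p)%:E)%E.
  have infK : (ereal_inf [set \int[g]_z ((N ((z.1 : V) - (z.2 : V))) `^ p)%:E
       | g in coupling mu nu] <= ((M + 2 * c) `^ p)%:E)%E.
    by rewrite (le_trans _ costK)//; apply: ereal_inf_lbound; exists gam.
  rewrite /Wp (_ : (M + 2 * c)%:E = (((M + 2 * c) `^ p)%:E `^ p^-1)%E); last first.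
    by rewrite poweR_EFin -powRrM divff ?gt_eqF// powRr1.
  apply: gt0_ler_poweR => //.
    rewrite in_itv/= leey andbT; apply: le_ereal_inf_tmp => _ [g _ <-].
    exact: integral_ge0.
  by rewrite in_itv/= leey andbT lee_fin powR_ge0.
pose B (z : T * T) := al + be * (r z.1 + r z.2).
have B0 z : 0 <= B z by rewrite addr_ge0// mulr_ge0// addr_ge0.
have mr1 : measurable_fun [set: T * T] (fun z => r z.1) by exact: measurableT_comp.
have mr2 : measurable_fun [set: T * T] (fun z => r z.2) by exact: measurableT_comp.
have mB : measurable_fun [set: T * T] B.
  by apply: measurable_funD => //; apply: measurable_funM => //; exact: measurable_funD.
(* The infinite term dominates the cost on [Z], where no pointwise bound is available, and
   integrates to 0 because [Z] is null. *)
apply: (@le_trans _ _ (\int[gam]_z ((B z)%:E + ((cst +oo%E) \_ Z) z))%E).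
  apply: le_integral_ge0 => // z; rewrite patchE.
  have [_|/negP nZ] := boolP (z \in Z).
    by rewrite addey// leey.
  rewrite adde0 lee_fin (le_trans _ (abP _ _ _ _))//.
  rewrite ge0_ler_powR ?(ltW p0)// ?nnegrE ?(is_norm_ge0 Nn) ?addr_ge0 ?powR_ge0//.
  by apply: bnd => Zz; apply: nZ; rewrite inE.
rewrite ge0_integralD//; last 4 first.
- by move=> z _; rewrite lee_fin.
- exact/measurable_EFinP.
- by move=> z _; rewrite patchE; case: ifP => // _; rewrite leey.
- by apply: (measurable_restrictT _ mZ).1; exact: measurable_cst.
rewrite -integral_mkcond [X in (_ + X)%E]null_set_integral// adde0.
under eq_integral do rewrite /B EFinD EFinM EFinD.
rewrite ge0_integralD//; last 2 first.
- by move=> z _; rewrite -EFinD -EFinM lee_fin mulr_ge0// addr_ge0.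
- under eq_fun do rewrite -EFinD -EFinM.
  by apply/measurable_EFinP/measurable_funM => //; exact: measurable_funD.
rewrite integral_cst// [X in (_ * X)%E](@probability_setT _ _ _ gam) mule1.
rewrite ge0_integralZl_EFin//; last 2 first.
- by move=> z _; rewrite -EFinD lee_fin addr_ge0.
- under eq_fun do rewrite -EFinD.
  by apply/measurable_EFinP; exact: measurable_funD.
rewrite ge0_integralD//; last 4 first.
- by move=> z _; rewrite lee_fin.
- exact/measurable_EFinP.
- by move=> z _; rewrite lee_fin.
- exact/measurable_EFinP.
rewrite coupling_integral_fst// coupling_integral_snd//.
rewrite -abE EFinD EFinM EFinD leeD2l// lee_wpmul2l ?lee_fin//.
by rewrite leeD// (le_trans _ (_ : S%:E <= _)%E)// lee_fin.
Qed.

Lemma Wp_le_partition (Y : set V) (s : seq V) (g : V -> V -> R) (r : V -> R)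
    (eta S : R) :
  measurable (Y : set T) -> mu (~` Y) = 0%E -> nu (~` Y) = 0%E ->
  (forall v, v \in s -> measurable_fun (Y : set T) (g v)) ->
  (forall v x, v \in s -> Y x -> 0 <= g v x) ->
  (forall x, Y x -> \sum_(v <- s) g v x = 1) ->
  (forall v, v \in s -> (\int[mu]_(x in (Y : set T)) (g v x)%:E =
                         \int[nu]_(x in (Y : set T)) (g v x)%:E)%E) ->
  measurable_fun (Y : set T) r -> (forall x, Y x -> 0 <= r x) -> 0 <= eta -> 0 <= S ->
  (\int[mu]_(x in (Y : set T)) (r x)%:E <= S%:E)%E ->
  (\int[nu]_(x in (Y : set T)) (r x)%:E <= S%:E)%E ->
  (forall v x, v \in s -> Y x -> g v x != 0 -> N (x - v) <= eta + r x `^ p^-1) ->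
  (Wp N p mu nu <= (2 * eta + 2 * S `^ p^-1)%:E)%E.
Proof.
move=> mY muY nuY mg g0 g1 gE mr r0 eta0 S0 muS nuS bnd.
(* Extension by zero off [Y] and off [s], so that measurability, sign and finiteness hold for every
   index and every point, as gluing requires. *)
pose f v : T -> R := if v \in s then (g v : T -> R) \_ Y else cst 0.
have mf v : measurable_fun setT (f v).
  rewrite /f; case: ifPn => [vs|_]; last exact: measurable_cst.
  by apply: (measurable_restrictT _ mY).1; exact: mg.
have f0 v x : 0 <= f v x.
  rewrite /f; case: ifPn => [vs|//]; rewrite patchE; case: ifPn => // /set_mem xY.
  exact: g0.
have f1 x : Y x -> \sum_(v <- s) f v x = 1.
  move=> Yx; rewrite -(g1 _ Yx) big_seq [RHS]big_seq; apply: eq_bigr => v vs.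
  by rewrite /f vs patchE mem_set.
have ae1 (m' : probability T R) : m' (~` Y) = 0%E ->
    {ae m', forall x, \sum_(v <- s) f v x = 1}.
  move=> m'Y; exists (~` Y); split => //; first exact: measurableC.
  by move=> x /= nx; apply: contra_not nx => /f1.
have fg (m' : probability T R) v : v \in s ->
    (\int[m']_x (f v x)%:E = \int[m']_(x in (Y : set T)) (g v x)%:E)%E.
  move=> vs; rewrite [RHS]integral_mkcond; apply: eq_integral => x _.
  by rewrite /f vs !patchE; case: ifP.
have fE v : (\int[mu]_x (f v x)%:E = \int[nu]_x (f v x)%:E)%E.
  have [vs|vs] := boolP (v \in s); first by rewrite !fg// gE.
  by rewrite /f (negbTE vs) !integral0.
have f_le1 v x : f v x <= 1.
  rewrite /f; case: ifPn => [vs|//]; rewrite patchE; case: ifPn => // /set_mem xY.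
  rewrite -(g1 _ xY) (big_rem v)//= lerDl big_seq sumr_ge0// => w /mem_rem ws.
  exact: g0.
pose w v := fine (\int[mu]_x (f v x)%:E)%E.
have fw v : (\int[mu]_x (f v x)%:E = (w v)%:E)%E.
  rewrite /w fineK// ge0_fin_numE; last by apply: integral_ge0 => x _; rewrite lee_fin.
  apply: (@le_lt_trans _ _ (\int[mu]_x (cst 1%:E x))%E).
    by apply: le_integral_ge0 => x; rewrite lee_fin.
  by rewrite integral_cst// [X in (_ * X)%E]probability_setT mule1 ltry.
have fw' v : (\int[nu]_x (f v x)%:E = (w v)%:E)%E by rewrite -fE.
have [gam [gmu gnu [Z [mZ Z0 ZP]]]] := glued_coupling mf mf f0 f0 fw fw'
  (ae1 _ muY) (ae1 _ nuY).
pose r' : T -> R := (r : T -> R) \_ Y.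
have r'E (m' : probability T R) :
    (\int[m']_x (r' x)%:E = \int[m']_(x in (Y : set T)) (r x)%:E)%E.
  rewrite [RHS]integral_mkcond; apply: eq_integral => x _.
  by rewrite /r' !patchE; case: ifP.
apply: (@Wp_le_coupling gam Z r') => //.
- by move=> A mA; split; [exact: gmu|exact: gnu].
- exact: (measurable_restrictT _ mY).1.
- by move=> x; rewrite /r' patchE; case: ifPn => // /set_mem/r0.
- by rewrite mulr_ge0.
- by rewrite r'E.
- by rewrite r'E.
- have fN v x : f v x != 0 -> N ((x : V) - v) <= eta + r' x `^ p^-1.
    rewrite /f; case: ifPn => [vs|]; last by rewrite eqxx.
    rewrite patchE; case: ifPn => [xY gx|]; last by rewrite eqxx.
    by rewrite /r' patchE xY; apply: bnd => //; exact: set_mem.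
  move=> [x y] /ZP[v vs [/fN/= vx /fN/= vy]].
  have := is_norm_triangle Nn v x y; rewrite (is_norm_distC Nn v y); lra.
Qed.

End Wasserstein.

(** * Integrals of functions in the affine span *)

Section Span1.
Context (R : realType) (m : nat).
Local Notation V := 'rV[R]_m.
Local Notation T := (borelV R m).
Variables (p : R) (U Y : set V) (G : set (V -> R)).
Hypotheses (p1 : 1 <= p) (mY : measurable (Y : set T)) (YU : Y `<=` U).

(** As [1 <= p], [|g|] is dominated by [1 + |g|^p], which is integrable for a probability
    measure. *)
Lemma in_Lp_integrable (mu : probability T R) (g : V -> R) :
  in_Lp p Y mu g -> mu.-integrable (Y : set T) (EFin \o g).
Proof.
move=> [mg gp].
have mgE : measurable_fun (Y : set T) (EFin \o g) by exact/measurable_EFinP.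
have mgp : measurable_fun (Y : set T) (fun x => `|g x| `^ p).
  apply: (measurableT_comp (measurable_powR p)).
  exact: measurableT_comp.
apply: (@le_integrable _ _ _ _ _ mY _ (fun x => (1 + `|g x| `^ p)%:E)) => //.
  move=> x _ /=; rewrite lee_fin (ger0_norm (addr_ge0 _ (powR_ge0 _ _)))//.
  have [g1|g1] := leP `|g x| 1; first by rewrite (le_trans g1)// lerDl powR_ge0.
  rewrite (@le_trans _ _ (`|g x| `^ p)) ?lerDr//.
  by rewrite -[leLHS]powRr1// ler_powR// ltW.
apply: (@integrableD _ _ _ _ _ mY (EFin \o cst 1) (fun x => (`|g x| `^ p)%:E)).
  exact: finite_measure_integrable_cst.
apply/integrableP; split; first exact/measurable_EFinP.
by under eq_integral do rewrite gee0_abs ?lee_fin ?powR_ge0//.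
Qed.

Lemma span1_measurable (f : V -> R) : span1 U G f ->
  (forall g, G g -> measurable_fun (Y : set T) g) -> measurable_fun (Y : set T) f.
Proof.
move=> [n [y0 [y [g [Gg fE]]]]] mG.
apply: (@eq_measurable_fun _ _ T R Y (fun x : V => y0 + \sum_(j < n) y j * g j x)).
  by move=> x /set_mem /YU /fE.
apply: measurable_funD => //; apply: measurable_sum => j.
by apply: measurable_funM => //; exact: mG.
Qed.

(** The representation of [f] is fixed before the measure is, so one formula serves both [mu] and
    [nu]. The constant contributes [y0] because [Y] has full measure. *)
Lemma span1_integral (f : V -> R) : span1 U G f -> exists (n : nat) (y0 : R)
    (y : 'I_n -> R) (g : 'I_n -> V -> R), (forall j, G (g j)) /\
  forall mu : probability T R, mu (~` Y) = 0%E ->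
    (forall g, G g -> in_Lp p Y mu g) ->
    (\int[mu]_(x in (Y : set T)) (f x)%:E =
     y0%:E + \sum_(j < n) (y j)%:E * \int[mu]_(x in (Y : set T)) (g j x)%:E)%E.
Proof.
move=> [n [y0 [y [g [Gg fE]]]]]; exists n, y0, y, g; split=> // mu muY GL.
have intg j : mu.-integrable (Y : set T) (fun x => ((y j)%:E * (g j x)%:E)%E).
  by apply: integrableZl => //; apply: in_Lp_integrable; exact: GL.
have muY1 : mu Y = 1%E.
  have := probability_setC mu mY; rewrite muY => /esym/eqP.
  by rewrite sube_eq ?add0e// => /eqP.
transitivity (\int[mu]_(x in (Y : set T))
    (y0%:E + \sum_(j < n) (y j)%:E * (g j x)%:E))%E.
  apply: eq_integral => x /set_mem /YU /fE ->.
  by rewrite EFinD -sumEFin; under eq_bigr do rewrite EFinM.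
rewrite integralD//; last 2 first.
- exact: finite_measure_integrable_cst.
- exact: integrable_sum.
rewrite integral_cst// [X in (_ * X + _)%E]muY1 mule1 integral_sum//; congr (_ + _)%E.
apply: eq_bigr => j _; rewrite integralZl//; apply: in_Lp_integrable; exact: GL.
Qed.

Lemma span1_integrable (mu : probability T R) (f : V -> R) : span1 U G f ->
  (forall g, G g -> in_Lp p Y mu g) -> mu.-integrable (Y : set T) (EFin \o f).
Proof.
move=> [n [y0 [y [g [Gg fE]]]]] GL.
apply: (eq_integrable mY (fun x => y0%:E + \sum_(j < n) (y j)%:E * (g j x)%:E)%E).
  move=> x /set_mem /YU /fE /= ->.
  by rewrite EFinD -sumEFin; under [in RHS]eq_bigr do rewrite EFinM.
apply: integrableD => //; first exact: finite_measure_integrable_cst.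
apply: integrable_sum => // j _; apply: integrableZl => //.
by apply: in_Lp_integrable; exact: GL.
Qed.

Lemma span1_integral_eq (mu nu : probability T R) (f : V -> R) :
  mu (~` Y) = 0%E -> nu (~` Y) = 0%E ->
  (forall g, G g -> in_Lp p Y mu g) -> (forall g, G g -> in_Lp p Y nu g) ->
  G_equiv Y G mu nu -> span1 U G f ->
  (\int[mu]_(x in (Y : set T)) (f x)%:E = \int[nu]_(x in (Y : set T)) (f x)%:E)%E.
Proof.
move=> muY nuY muG nuG mn /span1_integral[n [y0 [y [g [Gg fE]]]]].
by rewrite !fE//; congr (_ + _)%E; apply: eq_bigr => j _; rewrite mn.
Qed.

End Span1.

(** * Polyhedral covers *)

Lemma sub_conv (R : realType) (m : nat) (S : set 'rV[R]_m) : S `<=` Defs.conv S.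
Proof.
move=> v Sv; exists 1%N, (fun=> 1), (fun=> v).
by split => //; rewrite big_ord1// scale1r.
Qed.

Section Cover.
Context (R : realType) (m : nat) (N : 'rV[R]_m -> R) (Y : set 'rV[R]_m).
Context (k : nat) (C : 'I_k -> set 'rV[R]_m).
Local Notation V := 'rV[R]_m.
Local Notation T := (borelV R m).
Local Notation vertices := (finmap.enum_fset (fset_set (Vcover C))).
Hypotheses (Nn : is_norm N) (CY : polyhedral_cover Y C).

Lemma cover_polyhedron i : polyhedron (C i).
Proof. by case: CY. Qed.

Lemma Vset_nonempty i : Vset (C i) !=set0.
Proof. by case: CY => _ /(_ i). Qed.

Lemma finite_Vcover : finite_set (Vcover C).
Proof.
by apply: bigcup_finite => // i _; apply: finite_Vset; exact: cover_polyhedron.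
Qed.

Lemma finite_Dcover : finite_set (Dcover N C).
Proof.
by apply: bigcup_finite => // i _; apply: finite_Dset => //; exact: cover_polyhedron.
Qed.

Lemma cell_in_faces i : faces C (C i).
Proof.
split; last first.
  by exists i; apply: face_refl; apply: polyhedron_convex; exact: cover_polyhedron.
have [v [_ vC _]] := Vset_nonempty i.
by exists v; exact: vC.
Qed.

(** The supremum defining [mesh] is an upper bound only if the distances are bounded above, which
    follows from the finiteness of the vertex set. *)
Lemma le_mesh i v w : Vset (C i) v -> Vset (C i) w -> N (v - w) <= mesh N C.
Proof.
move=> Vv Vw; apply: ub_le_sup; last by exists i, v, w.
have fin : finite_set [set N (v - w) | v in Vcover C & w in Vcover C].
  by apply: finite_image2; exact: finite_Vcover.
have [s sE] := (finite_seqP _).1 fin.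
exists (\sum_(d <- s) `|d|) => _ [j [v' [w' [Vv' [Vw' ->]]]]].
have ds : [set` s] (N (v' - w')).
  by rewrite -sE; exists v'; [exists j|exists w' => //; exists j].
by rewrite (big_rem _ ds)/= (le_trans (ler_norm _))// lerDl sumr_ge0.
Qed.

Lemma mesh_ge0 : 0 <= mesh N C.
Proof.
have [k0|] := posnP k; last first.
  move=> k0; have [v Vv] := Vset_nonempty (Ordinal k0).
  by rewrite (le_trans _ (le_mesh Vv Vv))// (is_norm_ge0 Nn).
(* Without cells the set of distances is empty, and its [sup] is 0 by convention. *)
rewrite /mesh [X in sup X](_ : _ = set0) ?sup0//; apply/seteqP; split => //.
by move=> d [i _]; have := ltn_ord i; rewrite {2}k0.
Qed.

(** The distance to [v] is convex, so over a bounded cell it is at most its largest value at a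
    vertex. *)
Lemma dist_vertex_bounded i x v : Defs.bounded_set N (C i) -> C i x -> Vset (C i) v ->
  N (x - v) <= mesh N C.
Proof.
move=> [M CM] Cx Vv; have [n [A [b [_ CE]]]] := cover_polyhedron i.
rewrite CE in CM Cx.
apply: (bounded_polyhedron_vertex_bound Nn CM) Cx => w Vw.
by apply: (@le_mesh i) => //; rewrite /Vset/= CE.
Qed.

Lemma dist_conv_vertex i y v : Defs.conv (Vset (C i)) y -> Vset (C i) v ->
  N (y - v) <= mesh N C.
Proof.
move=> [n [w [pts [w0 w1 Vpts ->]]]] Vv.
have -> : \sum_(j < n) w j *: pts j - v = \sum_(j < n) w j *: (pts j - v).
  under [RHS]eq_bigr do rewrite scalerBr.
  by rewrite big_split/= sumrN -scaler_suml w1 scale1r.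
have [_ NZ ND] := Nn.
rewrite -[leRHS]mul1r -w1 mulr_suml.
elim/big_ind2 : _ => [|a b c d ab cd|j _].
- by rewrite (is_norm0 Nn).
- by rewrite (le_trans (ND _ _))// lerD.
- by rewrite NZ ger0_norm// ler_wpM2l// (@le_mesh i).
Qed.

(** Any point [y] of the hull serves as a relay between [x] and [v]; the infimum is then taken over
    [y]. *)
Lemma dist_vertex_inf i x v : Vset (C i) v ->
  N (x - v) <= mesh N C + inf [set N (x - y) | y in Defs.conv (Vset (C i))].
Proof.
move=> Vv; rewrite -lerBlDl; apply: lb_le_inf.
  by exists (N (x - v)), v => //; exact: sub_conv.
move=> _ [y yV <-]; rewrite lerBlDl.
have := is_norm_triangle Nn y x v; have := dist_conv_vertex yV Vv; lra.
Qed.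

Section VertexInterpolation.
Variable g : V -> V -> R.
Hypothesis gV : vertex_interpolation C g.

Lemma vertex_interpolation_support i x v :
  C i x -> Vcover C v -> g v x != 0 -> Vset (C i) v.
Proof.
move=> Cx Vv; case: gV => _ _ _ g4; apply: contraPP => nV; apply/negP; rewrite negbK.
by rewrite (g4 (C i))//; exact: cell_in_faces.
Qed.

(** On a cell the functions of its own vertices sum to 1, and those of all other vertices vanish. *)
Lemma vertex_interpolation_sum i x : C i x ->
  \sum_(v <- vertices) g v x = 1.
Proof.
move=> Cx; case: gV => _ _ g3 _; rewrite -(g3 _ _ (cell_in_faces i) Cx).
rewrite -fsbig_finite; last exact: finite_Vcover.
apply/esym/fsbig_widen; first by move=> v Vv; exists i.
move=> v [Vv nV] /=; apply: contrapT => /eqP gv.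
by apply: nV; exact: vertex_interpolation_support gv.
Qed.

End VertexInterpolation.

Lemma closed_measurable_borelV : closed Y -> measurable (Y : set T).
Proof.
move=> cY; rewrite -(setCK Y); apply: measurableC; apply: sub_sigma_algebra.
exact: closed_openC.
Qed.

Variables (p : R) (G : set (V -> R)).
Hypotheses (p1 : 1 <= p) (cY : closed Y).
Variables mu nu : probability T R.
Hypotheses (muG : Pp_G N p Y G mu) (nuG : Pp_G N p Y G nu) (mn : G_equiv Y G mu nu).

(** Common form of both cases: [r] is 0 for a bounded cover and the sum of the radial functions
    otherwise. *)
Lemma Wp_le_interpolation (r : V -> R) (S : R) : interpolation_set C G ->
  measurable_fun (Y : set T) r -> (forall x, Y x -> 0 <= r x) -> 0 <= S ->
  (\int[mu]_(x in (Y : set T)) (r x)%:E <= S%:E)%E ->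
  (\int[nu]_(x in (Y : set T)) (r x)%:E <= S%:E)%E ->
  (forall i x v, Y x -> C i x -> Vset (C i) v ->
    N (x - v) <= mesh N C + r x `^ p^-1) ->
  (Wp N p mu nu <= (2 * mesh N C + 2 * S `^ p^-1)%:E)%E.
Proof.
move=> [g [gV gG]] mr r0 S0 muS nuS bnd.
have mY := closed_measurable_borelV cY.
have [[muY _] muL] := muG; have [[nuY _] nuL] := nuG.
have [_ _ YC _] := CY; have [g0 _ _ _] := gV.
have VE v : v \in vertices -> Vcover C v.
  have -> : (v \in vertices) = (v \in Vcover C) by exact: in_fset_set finite_Vcover v.
  by rewrite inE.
apply: (@Wp_le_partition _ _ _ _ p1 Nn _ _ Y vertices g r) => //.
- move=> v /VE/gG gv; apply: (span1_measurable YC gv) => h /muL.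
  by case.
- by move=> v x /VE Vv /YC Ux; exact: g0.
- by move=> x /YC[i _ Cx]; exact: (vertex_interpolation_sum gV Cx).
- by move=> v /VE/gG gv; exact: (span1_integral_eq p1 mY YC muY nuY muL nuL mn gv).
- exact: mesh_ge0.
- move=> v x /VE Vv Yx gvx; have [i _ Cx] := YC _ Yx.
  exact: bnd Yx Cx (vertex_interpolation_support gV Cx Vv gvx).
Qed.

Lemma Wp_le_bounded : cover_bounded N C -> interpolation_set C G ->
  (Wp N p mu nu <= (2 * mesh N C)%:E)%E.
Proof.
move=> CB CG.
have p0 : p^-1 != 0 by rewrite invr_eq0 gt_eqF// (lt_le_trans ltr01).
have -> : 2 * mesh N C = 2 * mesh N C + 2 * 0 `^ p^-1 by rewrite powR0// mulr0 addr0.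
apply: (@Wp_le_interpolation (cst 0)) => //.
- by rewrite integral0.
- by rewrite integral0.
- by move=> i x v _ Cx Vv; rewrite powR0// addr0; exact: (@dist_vertex_bounded i).
Qed.

Lemma Wp_le_radial (gb : V -> V -> R) : interpolation_set C G -> p_radial N p C gb ->
  (forall u, Dcover N C u -> span1 (\bigcup_i C i) G (gb u)) ->
  (Wp N p mu nu <= (2 * mesh N C)%:E + 2%:E *
    (\sum_(u \in Dcover N C) \int[mu]_(x in (Y : set T)) (gb u x)%:E) `^ p^-1)%E.
Proof.
move=> CG [gb0 gbN] gbG.
have mY := closed_measurable_borelV cY.
have [[muY _] muL] := muG; have [[nuY _] nuL] := nuG.
have [_ _ YC _] := CY.
have p0 : 0 < p by rewrite (lt_le_trans ltr01).
have finD := finite_Dcover.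
pose D := finmap.enum_fset (fset_set (Dcover N C)).
have DE u : (u \in D) = (u \in Dcover N C) by exact: in_fset_set finD u.
pose h u : V -> R := if u \in D then gb u else cst 0.
have hE u : u \in D -> h u = gb u by rewrite /h => ->.
have mh u : measurable_fun (Y : set T) (h u).
  rewrite /h; case: ifPn => [|_]; last exact: measurable_cst.
  rewrite DE inE => /gbG gu; apply: (span1_measurable YC gu) => g /muL.
  by case.
have h0 u x : Y x -> 0 <= h u x.
  move=> /YC Ux; rewrite /h; case: ifPn => // ; rewrite DE inE => Du.
  exact: gb0.
pose r x := \sum_(u <- D) h u x.
have intr (m' : probability T R) : (\int[m']_(x in (Y : set T)) (r x)%:E =
    \sum_(u <- D) \int[m']_(x in (Y : set T)) (h u x)%:E)%E.
  rewrite -(@ge0_integral_sum _ _ _ m' _ mY _ (fun u x => (h u x)%:E)).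
  - by apply: eq_integral => x _; rewrite sumEFin.
  - by move=> u; exact/measurable_EFinP.
  - by move=> u x Yx; rewrite lee_fin h0.
pose S := \sum_(u <- D) fine (\int[mu]_(x in (Y : set T)) (h u x)%:E)%E.
have muS : (\int[mu]_(x in (Y : set T)) (r x)%:E = S%:E)%E.
  rewrite intr /S -sumEFin; apply: eq_big_seq => u uD; rewrite fineK//.
  apply: integrable_fin_num => //; rewrite hE//.
  by apply: (span1_integrable p1 mY YC) muL; apply: gbG; rewrite DE inE in uD.
(* The radial functions lie in the span, so their integrals agree and a bound in terms of [mu] alone
   covers [nu] too. *)
have nuS : (\int[nu]_(x in (Y : set T)) (r x)%:E = S%:E)%E.
  rewrite -muS !intr; apply: eq_big_seq => u uD; rewrite hE//; apply/esym.
  apply: (span1_integral_eq p1 mY YC muY nuY muL nuL mn).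
  by apply: gbG; rewrite DE inE in uD.
have r0 x : Y x -> 0 <= r x by move=> Yx; apply: sumr_ge0 => u _; exact: h0.
have -> : (\sum_(u \in Dcover N C) \int[mu]_(x in (Y : set T)) (gb u x)%:E)%E = S%:E.
  rewrite -muS intr fsbig_finite//; apply: eq_big_seq => u uD.
  by rewrite hE.
rewrite poweR_EFin -EFinM -EFinD.
apply: (@Wp_le_interpolation r) => //.
- by apply: measurable_sum.
- by rewrite -lee_fin -muS integral_ge0// => x Yx; rewrite lee_fin r0.
- by rewrite muS.
- by rewrite nuS.
move=> i x v Yx Cx Vv.
have [Cb|nCb] := pselect (Defs.bounded_set N (C i)).
  by rewrite (le_trans (dist_vertex_bounded Cb Cx Vv))// lerDl powR_ge0.
rewrite (le_trans (dist_vertex_inf x Vv))// lerD2l.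
have inf0 : 0 <= inf [set N (x - y) | y in Defs.conv (Vset (C i))].
  apply: lb_le_inf => [|_ [y _ <-]]; last exact: (is_norm_ge0 Nn).
  by exists (N (x - v)), v => //; exact: sub_conv.
(* The infimum becomes the [p^-1] power of its [p]-th power, to which the radial inequality of the
   cell applies. *)
rewrite -[leLHS](powRr1 inf0) -[X in _ `^ X](divff (_ : p != 0)) ?gt_eqF// powRrM.
rewrite ge0_ler_powR ?invr_ge0 ?(ltW p0)// ?nnegrE ?powR_ge0 ?r0//.
rewrite (le_trans (gbN _ _ (cell_in_faces i) nCb Cx))//.
have DiD : Dset N (C i) `<=` Dcover N C by move=> u Du; exists i.
have -> : r x = \sum_(u <- D) gb u x by apply: eq_big_seq => u uD; rewrite hE.
(* The sum over all directions splits into those of the cell and the rest, which is nonnegative. *)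
rewrite -fsbig_finite// [leRHS](fsbigID (Dset N (C i)))//.
rewrite setIidr// lerDl fsumr_ge0// => u [Du _].
by apply: gb0 => //; exact: YC.
Qed.

End Cover.

Theorem theorem3p14 (R : realType) (m : nat) (p : R) (N : 'rV[R]_m -> R)
  (Y : set 'rV[R]_m) (k : nat) (C : 'I_k -> set 'rV[R]_m) (G : set ('rV[R]_m -> R)) :
  1 <= p -> is_norm N -> closed Y -> polyhedral_cover Y C ->
  (* (i) bounded cover *)
  (cover_bounded N C -> interpolation_set C G ->
   forall mu nu : probability (borelV R m) R,
     Pp_G N p Y G mu -> Pp_G N p Y G nu -> G_equiv Y G mu nu ->
     (Wp N p mu nu <= (2 * mesh N C)%:E)%E)
  /\
  (* (ii) unbounded cover *)
  (~ cover_bounded N C -> p_interpolation_set N p C G ->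
   forall gb : 'rV[R]_m -> 'rV[R]_m -> R,
     p_radial N p C gb ->
     (forall u, Dcover N C u -> span1 (\bigcup_i C i) G (gb u)) ->
   forall mu nu : probability (borelV R m) R,
     Pp_G N p Y G mu -> Pp_G N p Y G nu -> G_equiv Y G mu nu ->
     (Wp N p mu nu <= (2 * mesh N C)%:E
        + 2%:E * (\sum_(u \in Dcover N C) \int[mu]_(x in (Y : set (borelV R m))) (gb u x)%:E)
                  `^ p^-1)%E).
Proof.
move=> p1 Nn cY CY; split=> [CB CG mu nu muG nuG mn|_ [CG _] gb gbR gbG mu nu muG nuG mn].
  exact: (Wp_le_bounded Nn CY p1 cY muG nuG mn CB CG).
exact: (Wp_le_radial Nn CY p1 cY muG nuG mn CG gbR gbG).
Qed.
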